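(* Let $0\le m\le n$ with $n\ge 1$, and let $d_0,d_1,\dots,d_m\ge 1$ be integers. Consider the problem of minimizing $f_0(x)$ over $x\in\mathbb{R}^n$ subject to $f_1(x)=\cdots=f_m(x)=0$, where $f_i\in\mathbb{R}[x_1,\dots,x_n]$ has degree $d_i$ for $i=0,\dots,m$. If the polynomials $f_1,\dots,f_m$ are generic, then: (i) The affine variety $V=\{x\in\mathbb{C}^n: f_1(x)=\cdots=f_m(x)=0\}$ is smooth, i.e. the gradients $\nabla f_1(x),\dots,\nabla f_m(x)$ are linearly independent at every $x\in V$. (ii) The KKT condition holds at any (local or global) optimal solution $x^*\in\mathbb{R}^n$ of the problem: there exist $\lambda_1^*,\dots,\lambda_m^*\in\mathbb{R}$ such that $\nabla f_0(x^* )+\sum_{i=1}^m\lambda_i^*\nabla f_i(x^* )=0$ and $f_1(x^* )=\cdots=f_m(x^* )=0$. (iii) If $f_0$ is also generic, then the set $$K=\Big\{x\in V:\ \exists\,\lambda_1,\dots,\lambda_m\in\mathbb{C}\ \text{ such that }\ \nabla f_0(x)+\sum_{i=1}^m\lambda_i\nabla f_i(x)=0\Big\}$$ is finite.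
   Context: Genericity: a property holds for generic polynomials $f_i$ of degrees $d_i$ if it holds whenever the tuple of their coefficients (as polynomials of degree at most $d_i$) lies in some nonempty Zariski open subset of the corresponding coefficient space, depending only on $n$ and the degrees. In (i) and (ii) the open set is in the coefficient space of $(f_1,\dots,f_m)$, and $f_0$ is arbitrary; in (iii) it is in the coefficient space of $(f_0,f_1,\dots,f_m)$. Here $\nabla$ is the gradient with respect to $x_1,\dots,x_n$. *)

(* Defs.v *)
From HB Require Import structures.
From mathcomp Require Import all_boot all_order all_algebra.
From mathcomp Require Import mpoly complex.
From mathcomp Require Import boolp classical_sets cardinality reals.
From mathcomp Require Import topology normedtype.
Set Implicit Arguments.
Unset Strict Implicit.
Unset Printing Implicit Defensive.
Import Order.TTheory GRing.Theory Num.Theory.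
Import numFieldNormedType.Exports.
Local Open Scope classical_set_scope.
Local Open Scope ring_scope.

(** The affine space [K^I] over a finite index type [I]: the coordinate rings
    of the library are indexed by ['I_#|I|], hence the use of [enum_val]. *)
Definition zariski_closed (K : fieldType) (I : finType) (Z : set (I -> K)) :=
  exists S : set {mpoly K[#|I|]},
    Z = [set c | forall p, S p -> p.@[fun k => c (enum_val k)] = 0].

Definition zariski_open (K : fieldType) (I : finType) (U : set (I -> K)) :=
  zariski_closed (~` U).

Section Genericity.
Variables (R : fieldType) (n k : nat) (d : 'I_k -> nat).

(** ['X_{1..n < (d i).+1}] is the type of monomials in [n] variables of total
    degree at most [d i]. *)
Definition coef_index : finType := {i : 'I_k & 'X_{1..n < (d i).+1}}.

Definition coef_tuple (f : 'I_k -> {mpoly R[n]}) : coef_index -> R :=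
  fun u => (f (tag u))@_(bmnm (tagged u)).

(** [msize p] is one more than the total degree of [p] (and [msize 0 = 0]). *)
Definition has_degrees (f : 'I_k -> {mpoly R[n]}) :=
  forall i, msize (f i) = (d i).+1.

Definition generically (P : ('I_k -> {mpoly R[n]}) -> Prop) :=
  exists U : set (coef_index -> R),
    [/\ zariski_open U, U !=set0 &
        forall f, has_degrees f -> U (coef_tuple f) -> P f].
End Genericity.

Definition evalv (K : comNzRingType) (n : nat) (p : {mpoly K[n]})
    (x : 'rV[K]_n) : K :=
  p.@[fun j => x 0 j].

Definition gradient (K : comNzRingType) (n : nat) (p : {mpoly K[n]})
    (x : 'rV[K]_n) : 'rV[K]_n :=
  \row_j evalv p^`M(j) x.

Definition zero_locus (K : comNzRingType) (n m : nat)
    (f : 'I_m -> {mpoly K[n]}) : set 'rV[K]_n :=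
  [set x | forall i, evalv (f i) x = 0].

Definition kkt_stationary (K : comNzRingType) (n m : nat) (f0 : {mpoly K[n]})
    (f : 'I_m -> {mpoly K[n]}) (x : 'rV[K]_n) :=
  exists lambda : 'I_m -> K,
    gradient f0 x + \sum_(i < m) lambda i *: gradient (f i) x = 0.

Definition smooth_locus (K : fieldType) (n m : nat)
    (f : 'I_m -> {mpoly K[n]}) :=
  forall x, zero_locus f x -> free [tuple gradient (f i) x | i < m].

Section Optimization.
Variables (R : realType) (n m : nat).
Variables (f0 : {mpoly R[n]}) (f : 'I_m -> {mpoly R[n]}).

Definition global_minimizer (x : 'rV[R]_n) :=
  zero_locus f x /\
  forall y, zero_locus f y -> evalv f0 x <= evalv f0 y.

Definition local_minimizer (x : 'rV[R]_n) :=
  zero_locus f x /\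
  \forall y \near x, zero_locus f y -> evalv f0 x <= evalv f0 y.
End Optimization.

Definition complexify (R : realType) (n : nat) (p : {mpoly R[n]}) :
    {mpoly R[i][n]} :=
  map_mpoly (real_complex R) p.

Definition complexifys (R : realType) (n m : nat) (f : 'I_m -> {mpoly R[n]}) :
    'I_m -> {mpoly R[i][n]} :=
  fun i => complexify (f i).

(** For a family indexed by [0, 1, ..., m], its members [1, ..., m]. *)
Definition constraints (T : Type) (m : nat) (f : 'I_m.+1 -> T) : 'I_m -> T :=
  fun i => f (lift ord0 i).

(* Main.v *)
Require Import Defs.
From mathcomp Require Import all_boot all_order all_algebra.
From mathcomp Require Import mpoly complex.
From mathcomp Require Import boolp classical_sets cardinality reals.
From mathcomp Require Import topology normedtype.
From mathcomp Require Import derive zify.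

(** The proof rests on one parametrization of families of polynomials by their
    critical points, on algebraic dependence, and on a penalty argument.

    Fix a family [f] and an index [j], and call [x] a constrained critical point
    when [f i] vanishes at [x] for all [i] other than [j] and, for some
    multipliers [lambda], the gradient of [f j] plus the [lambda]-combination of
    the other gradients is zero.  For given [x], [lambda] and value [s] of [f j]
    at [x], these conditions are affine in [f] and can be solved for the linear
    coefficients of [f j] and for the constant coefficients of all the [f i].
    That frees exactly as many coefficients as there are unknowns [x], [lambda],
    [s], so storing the unknowns in the freed places gives a polynomial map from
    the coefficient space to itself: [critical_decode], with partial inverse
    [critical_encode].  If [N] is the dimension of that space, then the [N]
    components of the map together with one more coordinate [p_k] are [N.+1]
    polynomials in [N] variables, hence algebraically dependent
    ([mpoly_alg_dep]).  Read as a polynomial in [p_k] over the coefficient space,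
    the relation has two consequences.  Where its leading coefficient does not
    vanish, the coordinate [p_k] of the critical points is confined to the roots
    of a nonzero polynomial; doing this for every coordinate of [x] gives the
    finiteness of the set of KKT points ([generic_critical_points_algebraic]
    with [j] the index of the objective).  With [p_k] the critical value [s],
    after division by a power of [s], the constant coefficient must vanish
    wherever [0] is a critical value; so generically it is not
    ([generic_critical_values_nonzero]).  A linear dependence between the
    gradients of the constraints at a point of the variety, normalized at a
    nonzero coefficient [mu j], is a constrained critical point of [f j] with
    value [0], whence smoothness.  All the relations have real coefficients
    while the points are complex.

    The KKT condition follows from smoothness.  Around a local minimizer [x],
    the minimizers on a small box of the objective plus the squared distance to
    [x] plus a large multiple of the sum of the squared constraints lie in the
    interior, so that arbitrarily close to [x] there are points [y] where the
    gradient of the objective plus [2 (y - x)] is in the span of the gradients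
    of the constraints.  Multiplied by the Gram determinant, the component
    orthogonal to this span is polynomial in [y] ([span_defect]), so by
    continuity it vanishes at [x] as well, where the Gram determinant is nonzero
    ([lagrange_multipliers]). *)

Set Implicit Arguments.
Unset Strict Implicit.
Unset Printing Implicit Defensive.
Import Order.TTheory GRing.Theory Num.Theory.
Import numFieldNormedType.Exports.
Local Open Scope classical_set_scope.
Local Open Scope ring_scope.

(** * Algebraic dependence of polynomials *)

Lemma msize_le_mul n (F : idomainType) (p q : {mpoly F[n]}) a b :
  (msize p <= a.+1)%N -> (msize q <= b.+1)%N -> (msize (p * q) <= (a + b).+1)%N.
Proof.
have [->|p0] := eqVneq p 0; first by rewrite mul0r msize0.
have [->|q0] := eqVneq q 0; first by rewrite mulr0 msize0.
move=> ha hb; rewrite msizeM // -subn1 leq_subLR add1n.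
by rewrite -addnS -addSn leq_add.
Qed.

Lemma msize_le_exp n (F : idomainType) (p : {mpoly F[n]}) a k :
  (msize p <= a.+1)%N -> (msize (p ^+ k) <= (k * a).+1)%N.
Proof.
move=> ha; elim: k => [|k IH]; first by rewrite expr0 msize1.
by rewrite exprS mulSn msize_le_mul.
Qed.

Lemma msize_le_prod n (F : idomainType) (I : finType) (p : I -> {mpoly F[n]}) a :
  (forall i, (msize (p i) <= a.+1)%N) ->
  (msize (\prod_i p i) <= (#|I| * a).+1)%N.
Proof.
move=> ha; rewrite cardE -big_enum /=; elim: (enum I) => [|i s IH] /=.
  by rewrite big_nil msize1.
by rewrite big_cons mulSn msize_le_mul.
Qed.

(** Counting: with all exponents below [s], there are [s ^ N.+1] monomials in
    the components of [phi] and [psi], which all lie in a space of dimension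
    [O(s ^ N)]; a nontrivial element of the kernel of the coefficient matrix is
    the relation.  Separating the exponent of [psi] from the others presents the
    relation as a univariate polynomial, which is the form that its two uses
    need. *)
Lemma mpoly_alg_dep (F : fieldType) N (phi : 'I_N -> {mpoly F[N]})
    (psi : {mpoly F[N]}) :
  exists2 Q : {poly {mpoly F[N]}}, Q != 0 &
    (map_poly (mmap (@mpolyC N F) phi) Q).[psi] = 0.
Proof.
pose D := (\max_i msize (phi i) + msize psi)%N.
have phiD i : (msize (phi i) <= D.+1)%N.
  by apply/leqW/(leq_trans _ (leq_addr _ _))/(leq_bigmax (F := fun i => msize (phi i))).
have psiD : (msize psi <= D.+1)%N by apply/leqW/leq_addl.
(* [T] bounds the degree of a product of powers below [s], and [T.+1 <= B * s],
   so that [s > B ^ N] makes the box of exponents [E] larger than [E']. *)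
pose B := (N.+1 * D).+1; pose s := (B ^ N).+1; pose T := (N * (s * D) + s * D)%N.
pose E := ({ffun 'I_N -> 'I_s} * 'I_s)%type.
pose E' := {ffun 'I_N -> 'I_T.+1}.
pose q (e : E) := \prod_i phi i ^+ e.1 i * psi ^+ e.2.
have q_deg e : (msize (q e) <= T.+1)%N.
  have le_s (k : 'I_s) p : (msize p <= D.+1)%N ->
      (msize ((p : {mpoly F[N]}) ^+ k) <= (s * D).+1)%N.
    move=> pD; apply: (leq_trans (msize_le_exp k pD)).
    by rewrite ltnS leq_mul2r ltnW ?orbT.
  apply: msize_le_mul; last exact: le_s.
  have := @msize_le_prod N F 'I_N (fun i => phi i ^+ e.1 i) (s * D).
  by rewrite card_ord; apply=> i; apply: le_s.
have card_lt : (#|{: E'}| < #|{: E}|)%N.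
  rewrite card_prod !card_ffun !card_ord.
  apply: (@leq_ltn_trans ((B * s) ^ N)%N).
    have le_T : (T.+1 <= B * s)%N by rewrite /T /B /=; nia.
    have le_exp a b k : (a <= b -> a ^ k <= b ^ k)%N.
      by case: k => // k; rewrite leq_exp2r.
    exact: le_exp.
  by rewrite expnMn mulnC ltn_pmul2l ?expn_gt0.
pose A := \matrix_(i < #|{: E}|, j < #|{: E'}|)
  (q (enum_val i))@_[multinom (enum_val j i' : nat) | i' < N].
have kerA : kermx A != 0.
  rewrite -mxrank_eq0 mxrank_ker subn_eq0 -ltnNge.
  exact: leq_ltn_trans (rank_leq_col A) card_lt.
have /rowV0Pn[u /sub_kermxP uA u0] := kerA.
pose M (e : E) := [multinom (e.1 i : nat) | i < N].
pose Q := \sum_(e : E) (u 0 (enum_rank e) *: 'X_[M e] : {mpoly F[N]}) *: 'X^(e.2).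
have Qcoef (e : E) : Q`_(e.2)@_(M e) = u 0 (enum_rank e).
  rewrite coef_sum raddf_sum /= (bigD1 e) //= big1 ?addr0.
    by rewrite coefZ coefXn eqxx mulr1 mcoeffZ mcoeffX eqxx mulr1.
  move=> [f k] /= ne; rewrite coefZ coefXn; case: eqP => [ek|_]; last first.
    by rewrite mulr0 mcoeff0.
  rewrite mulr1 mcoeffZ mcoeffX; case: eqP => [eM|_]; last by rewrite mulr0.
  case/eqP: ne; rewrite [e]surjective_pairing; congr (_, _); last exact/val_inj.
  apply/ffunP=> i; apply/val_inj.
  by have := congr1 (fun m : 'X_{1..N} => m i) eM; rewrite !mnmE.
exists Q.
  apply: contra_neq u0 => Q0; apply/rowP=> j; rewrite mxE.
  by rewrite -[j]enum_valK -Qcoef Q0 coef0 mcoeff0.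
have -> : (map_poly (mmap (@mpolyC N F) phi) Q).[psi] =
          \sum_(e : E) u 0 (enum_rank e) *: q e.
  rewrite rmorph_sum horner_sum; apply: eq_bigr => e _ /=.
  rewrite map_polyZ map_polyXn hornerZ hornerXn /= mmapZ mmapX mul_mpolyC.
  rewrite -scalerAl; congr (_ *: (_ * _)).
  by apply: eq_bigr => i _; rewrite mnmE.
apply/mpolyP=> m; rewrite mcoeff0 raddf_sum /=.
under eq_bigr do rewrite mcoeffZ.
have [/forallP mT|] := boolP [forall i, m i < T.+1]%N; last first.
  rewrite negb_forall => /existsP[i mi]; apply: big1 => e _.
  rewrite (_ : _@_m = 0) ?mulr0 //; apply: memN_msupp_eq0.
  apply: msize_mdeg_ge; apply: leq_trans (q_deg e) _.
  rewrite -leqNgt in mi; apply: leq_trans mi _.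
  by rewrite mdegE (bigD1 i) //= leq_addr.
pose e' : E' := [ffun i => Ordinal (mT i)].
have := congr1 (fun v : 'rV_ _ => v 0 (enum_rank e')) uA; rewrite !mxE => {2}<-.
rewrite (reindex (@enum_val _ (mem {: E}))) /=; last first.
  by exists enum_rank => i _; [exact: enum_valK|exact: enum_rankK].
apply: eq_bigr => i _; rewrite enum_valK mxE enum_rankK; congr (_ * _@_ _).
by apply/mnmP=> l; rewrite mnmE ffunE.
Qed.

Lemma mmap_mmap (F : comNzRingType) (K : comNzRingType) (iota : {rmorphism F -> K}) n N
    (phi : 'I_n -> {mpoly F[N]}) (p : 'I_N -> K) (q : {mpoly F[n]}) :
  mmap iota p (mmap (@mpolyC N F) phi q) =
  mmap iota (fun i => mmap iota p (phi i)) q.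
Proof.
rewrite [mmap (@mpolyC N F) phi q]/mmap rmorph_sum; apply: eq_bigr => m _ /=.
rewrite rmorphM /= mmapC rmorph_prod; congr (_ * _).
by apply: eq_bigr => i _; rewrite rmorphXn.
Qed.

Lemma mmap_horner_relation (F : fieldType) (K : comNzRingType)
    (iota : {rmorphism F -> K}) N (phi : 'I_N -> {mpoly F[N]}) (k : 'I_N)
    (Q : {poly {mpoly F[N]}}) (p : 'I_N -> K) :
  mmap iota p (map_poly (mmap (@mpolyC N F) phi) Q).['X_k] =
  (map_poly (mmap iota (fun i => mmap iota p (phi i))) Q).[p k].
Proof.
rewrite -horner_map /= mmapX mmap1U -map_poly_comp; congr (_.[_]).
by apply: eq_map_poly => q /=; rewrite mmap_mmap.
Qed.

(** The coordinate [p k] of a point of a fibre of [phi] satisfies an equation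
    whose coefficients depend on the image point only.  The relation is
    evaluated in any extension [K], because it has to be found over the field of
    definition of [phi] but holds for the points over larger fields. *)
Lemma coord_algebraic (F : fieldType) N (phi : 'I_N -> {mpoly F[N]}) (k : 'I_N) :
  exists2 Q : {poly {mpoly F[N]}}, Q != 0 &
    forall (K : comNzRingType) (iota : {rmorphism F -> K}) (p : 'I_N -> K),
      (map_poly (mmap iota (fun i => mmap iota p (phi i))) Q).[p k] = 0.
Proof.
have [Q Q0 Qphi] := mpoly_alg_dep phi 'X_k; exists Q => // K iota p.
by rewrite -mmap_horner_relation Qphi rmorph0.
Qed.

(** The image of a hyperplane under a polynomial map between spaces of the same
    dimension lies in a hypersurface: once the relation of [mpoly_alg_dep] is
    divided by the highest possible power of its variable, its constant
    coefficient is nonzero, and this is what remains of it on the hyperplane. *)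
Lemma hyperplane_image (F : fieldType) N (phi : 'I_N -> {mpoly F[N]}) (k : 'I_N) :
  exists2 P : {mpoly F[N]}, P != 0 &
    forall (K : comNzRingType) (iota : {rmorphism F -> K}) (p : 'I_N -> K),
      p k = 0 -> mmap iota (fun i => mmap iota p (phi i)) P = 0.
Proof.
have [Q Q0 Qphi] := mpoly_alg_dep phi 'X_k.
have [m [Q' /implyP/(_ Q0) Q'0 defQ]] := multiplicity_XsubC Q 0.
exists Q'.[0] => // K iota p pk0.
have Q'phi : (map_poly (mmap (@mpolyC N F) phi) Q').['X_k] = 0.
  move/eqP: Qphi; rewrite defQ rmorphM rmorphXn /= map_polyXsubC rmorph0 subr0.
  rewrite hornerM hornerXn mulf_eq0 => /orP[/eqP//|].
  by rewrite expf_eq0 -[_ == 0]msupp_eq0 msuppX andbF.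
have := mmap_horner_relation iota phi k Q' p.
by rewrite Q'phi rmorph0 pk0 => /esym; rewrite -horner_map rmorph0.
Qed.

(** * Points where a polynomial does not vanish *)

Lemma poly_nonroot (F : numDomainType) (q : {poly F}) :
  q != 0 -> exists t, q.[t] != 0.
Proof.
move=> q0; apply: contrapT => noroot.
pose rs := [seq i%:R : F | i <- iota 0 (size q)].
have rs_root : all (root q) rs.
  apply/allP => t _; apply/negPn/negP => qt; apply: noroot.
  by exists t; rewrite -rootE.
have rs_uniq : uniq rs.
  by rewrite map_inj_uniq ?iota_uniq // => a b /eqP; rewrite eqr_nat => /eqP.
by have := max_poly_roots q0 rs_root rs_uniq; rewrite size_map size_iota ltnn.
Qed.

Lemma meval_muni (F : comNzRingType) n (p : {mpoly F[n.+1]}) (v : 'I_n -> F) t :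
  p.@[fun i => if unlift ord_max i is Some j then v j else t] =
  (map_poly (meval v) (muni p)).[t].
Proof.
rewrite muniE mevalE rmorph_sum horner_sum; apply: eq_bigr => m _ /=.
rewrite map_polyZ map_polyXn hornerZ hornerXn /= mevalZ mevalX -mulrA.
rewrite big_ord_recr /= unlift_none; congr (_ * (_ * _)).
apply: eq_bigr => i _; rewrite mnmE.
have -> : widen_ord (leqnSn n) i = lift ord_max i.
  by apply/val_inj; rewrite /= /bump leqNgt ltn_ord.
by rewrite liftK.
Qed.

Lemma muni_eq0 (F : comNzRingType) n (p : {mpoly F[n.+1]}) :
  muni p = 0 -> p = 0.
Proof.
move=> p0; apply/mpolyP=> M; rewrite mcoeff0.
pose w (m : 'X_{1..n.+1}) := [multinom m (widen_ord (leqnSn n) i) | i < n].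
have := congr1 (fun q : {poly _} => q`_(M ord_max)@_(w M)) p0.
rewrite coef0 mcoeff0 => <-; rewrite muniE coef_sum raddf_sum /=.
under eq_bigr do rewrite coefZ coefXn -scalerAl mcoeffZ.
have wI m : w m = w M -> m ord_max = M ord_max -> m = M.
  move=> wE mE; apply/mnmP=> i; case: (unliftP ord_max i) => [j|] -> //.
  have := congr1 (fun m : 'X_{1..n} => m j) wE; rewrite !mnmE.
  suff -> : widen_ord (leqnSn n) j = lift ord_max j by [].
  by apply/val_inj; rewrite /= /bump leqNgt ltn_ord.
have zero m : m != M ->
  p@_m * ('X_[w m] * (M ord_max == m ord_max)%:R : {mpoly F[n]})@_(w M) = 0.
  case: (M ord_max =P m ord_max) => [e|_]; last by rewrite !mulr0 mcoeff0 mulr0.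
  rewrite mulr1 mcoeffX; case: (w m =P w M) => [e'|_]; last by rewrite mulr0.
  by rewrite (wI m e') ?eqxx.
have [Mp|Mp] := boolP (M \in msupp p).
  rewrite (bigD1_seq M) ?msupp_uniq //= eqxx mulr1 mcoeffX eqxx mulr1.
  by rewrite big1 ?addr0.
rewrite big_seq big1 ?memN_msupp_eq0 // => m mp; apply: zero.
by apply: contraNneq Mp => <-.
Qed.

Lemma mpoly_nonzero_point (F : numFieldType) n (p : {mpoly F[n]}) :
  p != 0 -> exists v, p.@[v] != 0.
Proof.
elim: n p => [|n IH] p p0.
  exists (fun=> 0); apply: contra_neq p0 => pv; apply/mpolyP=> m.
  have all0 (m' : 'X_{1..0}) : m' = 0%MM by apply/mnmP; case.
  have p_C : p = (p@_0)%:MP.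
    by apply/mpolyP=> m'; rewrite (all0 m') mcoeffC eqxx mulr1.
  by rewrite mcoeff0 (all0 m) -pv [in RHS]p_C mevalC.
have q0 : lead_coef (muni p) != 0.
  by rewrite lead_coef_eq0; apply: contra_neq p0; apply: muni_eq0.
have [v qv] := IH _ q0.
have [|t pt] := @poly_nonroot F (map_poly (meval v) (muni p)).
  apply: contra_neq qv => q_v.
  by rewrite lead_coefE -coef_map q_v coef0.
by exists (fun i => if unlift ord_max i is Some j then v j else t); rewrite meval_muni.
Qed.

(** * Families of polynomials parametrized by their critical points *)

Lemma mderivXU (A : comNzRingType) n (i l : 'I_n) :
  ('X_i : {mpoly A[n]})^`M(l) = ((i == l)%:R)%:MP.
Proof.
rewrite mderivX mnm1E; have [->|_] := eqVneq i l; last by rewrite scale0r mpolyC0.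
have -> : (U_(l) - U_(l) = 0 :> 'X_{1..n})%MM.
  by apply/mnmP=> i'; rewrite mnmBE subnn mnm0E.
by rewrite mpolyX0 scale1r mpolyC1.
Qed.

Definition linear_form (A : comNzRingType) n (a : 'I_n -> A) : {mpoly A[n]} :=
  \sum_l a l *: 'X_l.

Definition drop_const (A : comNzRingType) n (q : {mpoly A[n]}) :=
  q - (q@_0)%:MP.

Definition drop_affine (A : comNzRingType) n (q : {mpoly A[n]}) :=
  drop_const q - linear_form (fun l => q@_U_(l)).

(** The unknowns replace the coefficients that they determine: [x] the linear
    coefficients of [f j], its critical value the constant coefficient of [f j],
    and [lambda i] the constant coefficient of [f i]. *)
Definition critical_encode (A : comNzRingType) n k (j : 'I_k) (x : 'I_n -> A)
    (lambda : 'I_k -> A) (f : 'I_k -> {mpoly A[n]}) (i : 'I_k) : {mpoly A[n]} :=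
  if i == j then drop_affine (f j) + linear_form x + ((f j).@[x])%:MP
  else drop_const (f i) + (lambda i)%:MP.

(** Recovers a family from its encoding: [a] are the linear coefficients that
    make the stationarity equations true at [x], and the last summand corrects
    the constant coefficients so that the members have the prescribed values at
    [x].  Only ring operations occur, so that decoding commutes with ring
    morphisms and makes sense for the generic family. *)
Definition critical_decode (A : comNzRingType) n k (j : 'I_k)
    (P : 'I_k -> {mpoly A[n]}) (i : 'I_k) : {mpoly A[n]} :=
  let x l := (P j)@_U_(l) in
  let g := drop_affine (P j) in
  let a l := \sum_(i | i != j) (P i)@_0 * ((P i)^`M(l)).@[x] + (g^`M(l)).@[x] in
  let h := if i == j then g - linear_form a else drop_const (P i) in
  h + ((if i == j then (P j)@_0 else 0) - h.@[x])%:MP.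

Section LinearForm.
Variables (A : comNzRingType) (n : nat).
Implicit Types (a x : 'I_n -> A) (q : {mpoly A[n]}).

Lemma mcoeff_linear_form a m :
  (linear_form a)@_m = \sum_l a l * (U_(l)%MM == m)%:R.
Proof.
by rewrite raddf_sum /=; apply: eq_bigr => l _; rewrite mcoeffZ mcoeffX.
Qed.

Lemma mcoeff0_linear_form a : (linear_form a)@_0 = 0.
Proof.
rewrite mcoeff_linear_form big1 // => l _.
by rewrite mnm1_eq0 mulr0.
Qed.

Lemma mcoeffU_linear_form a l : (linear_form a)@_U_(l) = a l.
Proof.
rewrite mcoeff_linear_form (bigD1 l) //= eqxx mulr1 big1 ?addr0 // => i il.
case: eqP => [/(congr1 (fun m : 'X_{1..n} => m i))|_]; last by rewrite mulr0.
by rewrite !mnm1E eqxx eq_sym (negbTE il).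
Qed.

Lemma mderiv_linear_form a l : (linear_form a)^`M(l) = (a l)%:MP.
Proof.
rewrite raddf_sum /= (bigD1 l) //= big1 => [|i il].
  by rewrite addr0 mderivZ mderivXU eqxx -mul_mpolyC mulr1.
by rewrite mderivZ mderivXU (negbTE il) scaler0.
Qed.

Lemma msize_linear_form a : (msize (linear_form a) <= 2)%N.
Proof.
rewrite msizeE; apply/bigmax_leqP_seq => m + _; rewrite mcoeff_msupp.
rewrite mcoeff_linear_form ltnS; apply: contraNT => m1.
rewrite big1 // => l _; case: eqP => [lm|_]; last by rewrite mulr0.
by rewrite -lm mdeg1 in m1.
Qed.

Lemma mcoeff0_drop_const q : (drop_const q)@_0 = 0.
Proof. by rewrite mcoeffB mcoeffC eqxx mulr1 subrr. Qed.

Lemma mderiv_drop_const q l : (drop_const q)^`M(l) = q^`M(l).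
Proof. by rewrite mderivB mderivC subr0. Qed.

Lemma meval_drop_const q x : (drop_const q).@[x] = q.@[x] - q@_0.
Proof. by rewrite mevalB mevalC. Qed.

Lemma mcoeffU_drop_const q l : (drop_const q)@_U_(l) = q@_U_(l).
Proof. by rewrite mcoeffB mcoeffC mnm1_eq0 mulr0 subr0. Qed.

Lemma mcoeff0_drop_affine q : (drop_affine q)@_0 = 0.
Proof. by rewrite mcoeffB mcoeff0_drop_const mcoeff0_linear_form subr0. Qed.

Lemma mcoeffU_drop_affine q l : (drop_affine q)@_U_(l) = 0.
Proof. by rewrite mcoeffB mcoeffU_drop_const mcoeffU_linear_form subrr. Qed.

Lemma drop_affine_affine q x c :
  drop_affine (drop_affine q + linear_form x + c%:MP) = drop_affine q.
Proof.
rewrite {1}/drop_affine /drop_const.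
have -> : (drop_affine q + linear_form x + c%:MP)@_0 = c.
  by rewrite 2!mcoeffD mcoeff0_drop_affine mcoeff0_linear_form mcoeffC eqxx mulr1
    !add0r.
rewrite addrK.
suff -> : linear_form (fun l => (drop_affine q + linear_form x + c%:MP)@_U_(l)) =
          linear_form x by rewrite addrK.
apply: eq_bigr => l _; rewrite 2!mcoeffD mcoeffU_drop_affine mcoeffU_linear_form.
by rewrite mcoeffC mnm1_eq0 mulr0 addr0 add0r.
Qed.

End LinearForm.

(** The derivatives at [x] of the members other than [f j] do not see their
    constant coefficients, and those of [f j] see its linear coefficients
    additively; so the stationarity equations determine these coefficients, and
    the values at [x] determine the constant ones. *)
Lemma critical_encodeK (A : comNzRingType) n k (j : 'I_k) (x : 'I_n -> A)
    (lambda : 'I_k -> A) (f : 'I_k -> {mpoly A[n]}) :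
  (forall i, i != j -> (f i).@[x] = 0) ->
  (forall l, ((f j)^`M(l)).@[x] +
     \sum_(i | i != j) lambda i * ((f i)^`M(l)).@[x] = 0) ->
  critical_decode j (critical_encode j x lambda f) =1 f.
Proof.
move=> fx0 kkt i; pose P := critical_encode j x lambda f.
have Pj : P j = drop_affine (f j) + linear_form x + ((f j).@[x])%:MP.
  by rewrite /P /critical_encode eqxx.
have Pi i' : i' != j -> P i' = drop_const (f i') + (lambda i')%:MP.
  by move=> ij; rewrite /P /critical_encode (negbTE ij).
have Pjx : (fun l => (P j)@_U_(l)) =1 x.
  move=> l; rewrite Pj 2!mcoeffD mcoeffU_drop_affine mcoeffU_linear_form.
  by rewrite mcoeffC mnm1_eq0 mulr0 addr0 add0r.
have Pj0 : (P j)@_0 = (f j).@[x].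
  by rewrite Pj 2!mcoeffD mcoeff0_drop_affine mcoeff0_linear_form mcoeffC eqxx mulr1
    !add0r.
have Pi0 i' : i' != j -> (P i')@_0 = lambda i'.
  by move=> ij; rewrite Pi // mcoeffD mcoeff0_drop_const mcoeffC eqxx mulr1 add0r.
pose h := drop_const (f i).
have hE : (if i == j then drop_affine (P j) - linear_form (fun l =>
     \sum_(i | i != j) (P i)@_0 * ((P i)^`M(l)).@[fun l => (P j)@_U_(l)] +
       ((drop_affine (P j))^`M(l)).@[fun l => (P j)@_U_(l)])
   else drop_const (P i)) = h.
  case: eqP => [ij|/eqP ij]; last first.
    rewrite Pi // /h {1}/drop_const mcoeffD mcoeff0_drop_const add0r.
    by rewrite mcoeffC eqxx mulr1 addrK.
  rewrite Pj drop_affine_affine -Pj /drop_affine /h ij -addrA -opprD.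
  rewrite -[RHS]subr0; congr (_ - _).
  rewrite -big_split /= big1 // => l _; rewrite -scalerDl.
  rewrite (meval_eq _ Pjx) mderivB mderiv_linear_form mevalB mevalC.
  rewrite mderiv_drop_const.
  rewrite [_ + (_ - _)]addrA subrKC.
  rewrite (eq_bigr (fun i' => lambda i' * ((f i')^`M(l)).@[x])).
    by rewrite addrC kkt scale0r.
  move=> i' ij'; rewrite Pi0 // (Pi i') // mderivD mderivC addr0.
  by rewrite mderiv_drop_const (meval_eq _ Pjx).
rewrite /critical_decode -/P hE (meval_eq _ Pjx) /h meval_drop_const.
have -> : (if i == j then (P j)@_0 else 0) = (f i).@[x].
  by case: eqP => [->|/eqP ij]; [rewrite Pj0|rewrite fx0].
by rewrite opprB subrKC /drop_const subrK.
Qed.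

Definition constrained_critical (A : comNzRingType) n k (j : 'I_k)
    (f : 'I_k -> {mpoly A[n]}) (x : 'I_n -> A) :=
  (forall i, i != j -> (f i).@[x] = 0) /\
  exists lambda : 'I_k -> A, forall l, ((f j)^`M(l)).@[x] +
    \sum_(i | i != j) lambda i * ((f i)^`M(l)).@[x] = 0.

Section Naturality.
Variables (A B : comNzRingType) (theta : {rmorphism A -> B}) (n : nat).
Implicit Types (q : {mpoly A[n]}).

Lemma meval_map_mpoly (v : 'I_n -> A) q :
  (map_mpoly theta q).@[fun i => theta (v i)] = theta q.@[v].
Proof.
rewrite {2}[q](mpolywE (leqnn _)) (map_mpolyE _ (leqnn _)) !(raddf_sum (meval _)).
rewrite (raddf_sum theta) /=.
apply: eq_bigr => m _; rewrite !mevalZ !mevalX rmorphM rmorph_prod /=.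
by under [in RHS]eq_bigr do rewrite rmorphXn.
Qed.

Lemma mderiv_map_mpoly q l :
  (map_mpoly theta q)^`M(l) = map_mpoly theta q^`M(l).
Proof.
by apply/mpolyP=> m; rewrite mcoeff_mderiv !mcoeff_map_mpoly mcoeff_mderiv raddfMn.
Qed.

Lemma map_mpoly_linear_form (a : 'I_n -> A) :
  map_mpoly theta (linear_form a) = linear_form (fun l => theta (a l)).
Proof.
by rewrite raddf_sum; apply: eq_bigr => l _ /=; rewrite map_mpolyZ map_mpolyX.
Qed.

Lemma map_mpoly_drop_const q :
  map_mpoly theta (drop_const q) = drop_const (map_mpoly theta q).
Proof. by rewrite rmorphB /= map_mpolyC /drop_const mcoeff_map_mpoly. Qed.

Lemma map_mpoly_drop_affine q :
  map_mpoly theta (drop_affine q) = drop_affine (map_mpoly theta q).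
Proof.
rewrite rmorphB /= map_mpoly_drop_const map_mpoly_linear_form; congr (_ - _).
by apply: eq_bigr => l _; rewrite mcoeff_map_mpoly.
Qed.

Lemma map_mpoly_critical_decode k (j : 'I_k) (P : 'I_k -> {mpoly A[n]}) i :
  map_mpoly theta (critical_decode j P i) =
  critical_decode j (fun i => map_mpoly theta (P i)) i.
Proof.
rewrite /critical_decode.
have evalE q : (map_mpoly theta q).@[fun l => (map_mpoly theta (P j))@_U_(l)] =
    theta q.@[fun l => (P j)@_U_(l)].
  by rewrite -meval_map_mpoly; apply: meval_eq => l; rewrite mcoeff_map_mpoly.
set x := fun l => (P j)@_U_(l).
pose a l := \sum_(i | i != j) (P i)@_0 * ((P i)^`M(l)).@[x] +
            ((drop_affine (P j))^`M(l)).@[x].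
have -> : (fun l => \sum_(i | i != j) (map_mpoly theta (P i))@_0 *
      ((map_mpoly theta (P i))^`M(l)).@[fun l => (map_mpoly theta (P j))@_U_(l)] +
      ((drop_affine (map_mpoly theta (P j)))^`M(l)).@[
        fun l => (map_mpoly theta (P j))@_U_(l)]) = (fun l => theta (a l)).
  apply/funext => l; rewrite rmorphD (rmorph_sum theta) /=; congr (_ + _).
    apply: eq_bigr => i' _.
    by rewrite mderiv_map_mpoly evalE mcoeff_map_mpoly rmorphM.
  by rewrite -map_mpoly_drop_affine mderiv_map_mpoly evalE.
rewrite -/a -map_mpoly_linear_form -map_mpoly_drop_affine -map_mpoly_drop_const.
rewrite -rmorphB -[if _ then map_mpoly _ _ else _]fun_if evalE.
rewrite rmorphD /= map_mpolyC; congr (_ + _%:MP).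
rewrite raddfB /=; congr (_ - _).
by case: eqP; rewrite ?rmorph0 // mcoeff_map_mpoly.
Qed.

End Naturality.

(** * The parametrization as a polynomial map of the coefficient space *)

Section Coefficients.
Variables (n k : nat) (d : 'I_k -> nat) (j : 'I_k).
Hypothesis dj_gt0 : (0 < d j)%N.

Let I := coef_index n d.
Let N := #|{: I}|.

Definition coef_poly (A : comNzRingType) (p : I -> A) (i : 'I_k) : {mpoly A[n]} :=
  \sum_(b : 'X_{1..n < (d i).+1})
     p (Tagged (fun i => 'X_{1..n < (d i).+1}) b) *: 'X_[b].

Lemma coef_polyK (A : comNzRingType) (f : 'I_k -> {mpoly A[n]}) i :
  (msize (f i) <= (d i).+1)%N ->
  coef_poly (fun u : I => (f (tag u))@_(bmnm (tagged u))) i = f i.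
Proof. by move=> fi; rewrite [RHS](mpolywE fi). Qed.

Definition lin_index (l : 'I_n) : I.
Proof.
refine (Tagged (fun i => 'X_{1..n < (d i).+1}) (i := j) (@BMultinom _ _ U_(l)%MM _)).
by rewrite mdeg1.
Defined.

Definition const_index : I.
Proof.
refine (Tagged (fun i => 'X_{1..n < (d i).+1}) (i := j) (@BMultinom _ _ 0%MM _)).
by rewrite mdeg0.
Defined.

(** Decoding of the generic family, whose coefficients are the variables. *)
Definition critical_map (F : fieldType) (m : 'I_N) : {mpoly F[N]} :=
  let X u := 'X_(enum_rank u) in
  (critical_decode j (coef_poly X) (tag (enum_val m)))@_(bmnm (tagged (enum_val m))).

(** A family with a constrained critical point is the image of its encoding.
    The hypothesis [0 < d j] ensures that the linear coefficients of [f j] are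
    coordinates of the coefficient space, hence that there is room for [x]. *)
Lemma critical_map_surj (F : fieldType) (K : comNzRingType)
    (iota : {rmorphism F -> K}) (f : 'I_k -> {mpoly K[n]}) (x : 'I_n -> K) :
  (forall i, (msize (f i) <= (d i).+1)%N) ->
  constrained_critical j f x ->
  exists p : 'I_N -> K,
    [/\ forall m, mmap iota p (critical_map F m) =
          (f (tag (enum_val m)))@_(bmnm (tagged (enum_val m))),
        forall l, p (enum_rank (lin_index l)) = x l &
        p (enum_rank const_index) = (f j).@[x]].
Proof.
move=> f_deg [fx0 [lambda kkt]].
pose P := critical_encode j x lambda f.
pose p (m : 'I_N) := (P (tag (enum_val m)))@_(bmnm (tagged (enum_val m))).
have const_deg i (c : K) : (msize (c%:MP_[n]) <= (d i).+1)%N.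
  by rewrite mmeasureC; case: (_ != _).
have msizeD (q r : {mpoly K[n]}) s : (msize q <= s)%N -> (msize r <= s)%N ->
    (msize (q + r) <= s)%N.
  by move=> qs rs; apply: leq_trans (mmeasureD_le _ _ _) _; rewrite geq_max qs rs.
have lin_deg a : (msize (linear_form a : {mpoly K[n]}) <= (d j).+1)%N.
  exact: leq_trans (msize_linear_form a) _.
have P_deg i : (msize (P i) <= (d i).+1)%N.
  rewrite /P /critical_encode; case: eqP => [->|_].
    rewrite msizeD ?const_deg // msizeD ?lin_deg // msizeD ?mmeasureN ?lin_deg //.
    by rewrite msizeD ?mmeasureN.
  by rewrite msizeD ?const_deg // msizeD ?mmeasureN.
exists p; split.
- move=> m; rewrite /critical_map.
  rewrite -(mcoeff_map_mpoly (mmap iota p)) map_mpoly_critical_decode.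
  rewrite -[in RHS](critical_encodeK fx0 kkt); congr (_@_ _).
  congr (critical_decode j _ _); apply/funext => i.
  rewrite -/P -(coef_polyK (P_deg i)) raddf_sum; apply: eq_bigr => b _ /=.
  by rewrite map_mpolyZ map_mpolyX /= mmapX mmap1U /p enum_rankK.
- move=> l; rewrite /p enum_rankK /= /P /critical_encode eqxx.
  rewrite 2!mcoeffD mcoeffU_drop_affine mcoeffU_linear_form.
  by rewrite mcoeffC mnm1_eq0 mulr0 addr0 add0r.
- rewrite /p enum_rankK /= /P /critical_encode eqxx.
  by rewrite 2!mcoeffD mcoeff0_drop_affine mcoeff0_linear_form mcoeffC eqxx mulr1
    !add0r.
Qed.

End Coefficients.

Lemma mmap_meval (F K : comNzRingType) (iota : {rmorphism F -> K}) n
    (v : 'I_n -> F) (q : {mpoly F[n]}) :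
  mmap iota (fun i => iota (v i)) q = iota q.@[v].
Proof.
rewrite mevalE rmorph_sum; apply: eq_bigr => m _ /=.
rewrite rmorphM rmorph_prod; congr (_ * _).
by apply: eq_bigr => i _; rewrite rmorphXn.
Qed.

(** * Critical points of generic families *)

Section GenericCriticalPoints.
Variables (F : fieldType) (n k : nat) (d : 'I_k -> nat) (j : 'I_k).
Hypothesis dj_gt0 : (0 < d j)%N.

Let N := #|{: coef_index n d}|.

Lemma critical_parameters (K : fieldType) (iota : {rmorphism F -> K})
    (f : 'I_k -> {mpoly F[n]}) (x : 'I_n -> K) :
  (forall i, (msize (f i) <= (d i).+1)%N) ->
  constrained_critical j (fun i => map_mpoly iota (f i)) x ->
  exists p : 'I_N -> K,
    [/\ (fun m => mmap iota p (@critical_map n k d j F m)) =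
          (fun m => iota (@coef_tuple F n k d f (enum_val m))),
        forall l, p (enum_rank (lin_index dj_gt0 l)) = x l &
        p (enum_rank (const_index n d j)) = (map_mpoly iota (f j)).@[x]].
Proof.
move=> f_deg /(critical_map_surj dj_gt0 iota)[|p [pf px pv]].
  move=> i; apply: leq_trans (f_deg i).
  rewrite msizeE; apply/bigmax_leqP_seq => m + _.
  by rewrite (perm_mem (msupp_map_mpoly _ (fmorph_inj iota))) => /msize_mdeg_lt.
exists p; split=> //; apply/funext => m.
by rewrite pf mcoeff_map_mpoly.
Qed.

(** The hypersurface to avoid is that of the leading coefficients of the
    equations satisfied by the coordinates of the critical points. *)
Lemma generic_critical_points_algebraic :
  exists2 P : {mpoly F[N]}, P != 0 &
    forall (K : fieldType) (iota : {rmorphism F -> K}) (f : 'I_k -> {mpoly F[n]}),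
      (forall i, (msize (f i) <= (d i).+1)%N) ->
      P.@[fun m => @coef_tuple F n k d f (enum_val m)] != 0 ->
      exists q : 'I_n -> {poly K}, forall l, q l != 0 /\
        forall x, constrained_critical j (fun i => map_mpoly iota (f i)) x ->
          root (q l) (x l).
Proof.
have algQ l := coord_algebraic (@critical_map n k d j F)
  (enum_rank (lin_index dj_gt0 l)).
pose Q l := s2val (cid2 (algQ l)).
exists (\prod_l lead_coef (Q l)) => [|K iota f f_deg].
  apply/prodf_neq0 => l _; rewrite lead_coef_eq0 /Q; by case: cid2.
pose c (m : 'I_N) := @coef_tuple F n k d f (enum_val m).
rewrite -/c rmorph_prod => /prodf_neq0 Qc.
exists (fun l => map_poly (mmap iota (fun m => iota (c m))) (Q l)) => l; split.
  apply: contra_neq (Qc l isT) => Ql.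
  by apply: (fmorph_inj iota); rewrite -mmap_meval rmorph0 lead_coefE -coef_map
    Ql coef0.
move=> x /(critical_parameters f_deg)[p [pc px _]].
rewrite /root -px -pc /Q; case: cid2 => q /= _ ->; exact: eqxx.
Qed.

(** Families with critical value [0] are images of encodings in a coordinate
    hyperplane. *)
Lemma generic_critical_values_nonzero :
  exists2 P : {mpoly F[N]}, P != 0 &
    forall (K : fieldType) (iota : {rmorphism F -> K}) (f : 'I_k -> {mpoly F[n]}),
      (forall i, (msize (f i) <= (d i).+1)%N) ->
      P.@[fun m => @coef_tuple F n k d f (enum_val m)] != 0 ->
      forall x, constrained_critical j (fun i => map_mpoly iota (f i)) x ->
        (map_mpoly iota (f j)).@[x] != 0.
Proof.
have [P P0 Pphi] := hyperplane_image (@critical_map n k d j F)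
  (enum_rank (const_index n d j)).
exists P => // K iota f f_deg; pose c (m : 'I_N) := @coef_tuple F n k d f (enum_val m).
rewrite -/c => Pc x.
move=> /(critical_parameters f_deg)[p [pc _ <-]].
apply: contra_neq Pc => p0; apply: (fmorph_inj iota).
by rewrite -mmap_meval rmorph0 -pc; apply: Pphi.
Qed.

End GenericCriticalPoints.

(** * Stationarity at local minimizers *)

Lemma mpoly_ring_ind (A : comNzRingType) n (S : {mpoly A[n]} -> Prop) :
  (forall c, S c%:MP) -> (forall i, S 'X_i) ->
  (forall p q, S p -> S q -> S (p + q)) ->
  (forall p q, S p -> S q -> S (p * q)) -> forall p, S p.
Proof.
move=> SC SX SD SM; elim/mpolyind => [|c m q _ _ Sq]; first by rewrite -mpolyC0.
apply: (SD) => //; rewrite -mul_mpolyC; apply: (SM) => //.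
rewrite mpolyXE_id; apply: (big_ind S) => [|p r|i _]; [by rewrite -mpolyC1|exact: SM|].
elim: (m i) => [|e IH]; first by rewrite expr0 -mpolyC1.
by rewrite exprS; apply: SM.
Qed.

Section LinePolynomial.
Variables (A : comNzRingType) (n : nat) (x : 'I_n -> A) (j : 'I_n).

(** Restriction to the line through [x] in the direction of the [j]-th axis
    reduces first order conditions to univariate polynomials. *)
Definition line_point (i : 'I_n) : {poly A} := (x i)%:P + (i == j)%:R *: 'X.

Lemma horner_mmap_line (p : {mpoly A[n]}) t :
  (mmap polyC line_point p).[t] = p.@[fun i => x i + (i == j)%:R * t].
Proof.
rewrite mevalE -[LHS]/(horner_eval t _) rmorph_sum; apply: eq_bigr => m _ /=.
rewrite /horner_eval hornerM hornerC horner_prod; congr (_ * _).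
by apply: eq_bigr => i _; rewrite horner_exp !hornerE.
Qed.

Lemma deriv_mmap_line (p : {mpoly A[n]}) :
  (mmap polyC line_point p)^`() = mmap polyC line_point p^`M(j).
Proof.
elim/mpoly_ring_ind: p => [c|i|p q Sp Sq|p q Sp Sq].
- by rewrite mderivC rmorph0 mmapC derivC.
- by rewrite mmapX mmap1U mderivXU mmapC derivD derivC add0r derivZ derivX alg_polyC.
- by rewrite mderivD !rmorphD derivD /= Sp Sq.
- by rewrite mderivM rmorphD !rmorphM derivM /= Sp Sq.
Qed.

Lemma deriv_line0 (p : {mpoly A[n]}) :
  (mmap polyC line_point p)^`().[0] = p^`M(j).@[x].
Proof.
rewrite deriv_mmap_line horner_mmap_line; apply: meval_eq => i.
by rewrite mulr0 addr0.
Qed.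

End LinePolynomial.

Lemma meval_sum_sqr (A : comNzRingType) n (I : finType) (q : I -> {mpoly A[n]})
    (v : 'I_n -> A) :
  (\sum_i q i ^+ 2).@[v] = \sum_i (q i).@[v] ^+ 2.
Proof.
rewrite (raddf_sum (meval v)); apply: eq_bigr => i _ /=.
by rewrite !expr2 mevalM.
Qed.

Lemma meval_mderiv_sum_sqr (A : comNzRingType) n (I : finType)
    (q : I -> {mpoly A[n]}) (v : 'I_n -> A) l :
  ((\sum_i q i ^+ 2)^`M(l)).@[v] = \sum_i (q i).@[v] *+ 2 * ((q i)^`M(l)).@[v].
Proof.
rewrite (raddf_sum (mderiv l)) (raddf_sum (meval v)); apply: eq_bigr => i _ /=.
by rewrite expr2 mderivM mevalD !mevalM mulrC -mulr2n mulrnAl.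
Qed.

Definition sqdist (A : comNzRingType) n (x : 'I_n -> A) : {mpoly A[n]} :=
  \sum_l ('X_l - (x l)%:MP) ^+ 2.

Lemma meval_sqdist (A : comNzRingType) n (x y : 'I_n -> A) :
  (sqdist x).@[y] = \sum_l (y l - x l) ^+ 2.
Proof.
by rewrite meval_sum_sqr; under eq_bigr do rewrite mevalB mevalXU mevalC.
Qed.

Lemma mderiv_sqdist (A : comNzRingType) n (x : 'I_n -> A) l :
  (sqdist x)^`M(l) = ('X_l - (x l)%:MP) *+ 2.
Proof.
rewrite raddf_sum /= (bigD1 l) //= big1 => [|i il].
  by rewrite addr0 expr2 mderivM mderivB mderivC subr0 mderivXU eqxx mulr1 mul1r.
rewrite expr2 mderivM mderivB mderivC subr0 mderivXU (negbTE il) mpolyC0.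
by rewrite mul0r mulr0 addr0.
Qed.

(** The component of [v] orthogonal to the rows of [G], times the Gram
    determinant: without division, it is polynomial in the entries of [G] and
    [v], hence continuous even where the rows become dependent. *)
Definition span_defect (A : comNzRingType) m n (G : 'M[A]_(m, n)) (v : 'rV[A]_n) :
    'rV[A]_n :=
  \det (G *m G^T) *: v - v *m G^T *m \adj (G *m G^T) *m G.

Lemma map_span_defect (A B : comNzRingType) (theta : {rmorphism A -> B}) m n
    (G : 'M[A]_(m, n)) (v : 'rV[A]_n) :
  map_mx theta (span_defect G v) = span_defect (map_mx theta G) (map_mx theta v).
Proof.
by rewrite /span_defect map_mxB map_mxZ !map_mxM map_mx_adj -det_map_mx !map_mxM
  map_trmx.
Qed.

Lemma span_defect_span (A : comNzRingType) m n (G : 'M[A]_(m, n)) (u : 'rV[A]_m) :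
  span_defect G (u *m G) = 0.
Proof.
rewrite /span_defect -(mulmxA u G) -(mulmxA u _ (\adj _)) mul_mx_adj.
by rewrite mul_mx_scalar -scalemxAl subrr.
Qed.

Lemma span_defect_eq0 (K : fieldType) m n (G : 'M[K]_(m, n)) (v : 'rV[K]_n) :
  \det (G *m G^T) != 0 -> span_defect G v = 0 -> exists u, v = u *m G.
Proof.
move=> det0 /eqP; rewrite subr_eq0 => /eqP def_v.
exists ((\det (G *m G^T))^-1 *: (v *m G^T *m \adj (G *m G^T))).
by rewrite -scalemxAl -def_v scalerA mulVf // scale1r.
Qed.

(** A vector in the kernel of the Gram matrix is the coefficient vector of a
    combination of the rows of [G] whose sum of squares is zero. *)
Lemma gram_det_neq0 (K : realFieldType) m n (G : 'M[K]_(m, n)) :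
  (forall u : 'rV_m, u *m G = 0 -> u = 0) -> \det (G *m G^T) != 0.
Proof.
move=> G_free; apply/det0P => -[u u0 uGG].
case/eqP: u0; apply: G_free; apply/rowP => l; rewrite [in RHS]mxE.
have /matrixP/(_ 0 0) : (u *m G) *m (u *m G)^T = 0.
  by rewrite trmx_mul mulmxA -(mulmxA u) uGG mul0mx.
rewrite mxE [in RHS]mxE => /eqP; rewrite psumr_eq0 => [/allP/(_ l)|i _].
  rewrite mem_index_enum => /(_ isT) /=.
  by rewrite [_^T _ _]mxE mulf_eq0 orbb => /eqP.
by rewrite [_^T _ _]mxE -expr2 sqr_ge0.
Qed.

Lemma free_gradientsP (K : fieldType) n m (f : 'I_m -> {mpoly K[n]}) (x : 'rV[K]_n) :
  free [tuple gradient (f i) x | i < m] <->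
  (forall mu : 'I_m -> K, \sum_i mu i *: gradient (f i) x = 0 ->
     forall i, mu i = 0).
Proof.
have sumE (mu : 'I_m -> K) :
    \sum_(i < m) mu i *: [tuple gradient (f i) x | i < m]`_i =
    \sum_i mu i *: gradient (f i) x.
  by apply: eq_bigr => i _; rewrite -tnth_nth tnth_mktuple.
split=> [/freeP f_free mu|f_free]; last apply/freeP => mu.
  by rewrite -sumE; apply: f_free.
by rewrite sumE; apply: f_free.
Qed.

Section Lagrange.
Variables (R : realType) (n : nat).
Implicit Types (x y : 'rV[R]_n) (p : {mpoly R[n]}).

Lemma poly_local_min (q : {poly R}) e : 0 < e ->
  (forall t, `|t| < e -> q.[0] <= q.[t]) -> q^`().[0] = 0.
Proof.
move=> e0 qmin.
have min0 : is_derive (0 : R) 1 (horner q) 0.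
  apply: (@derive1_at_min R (horner q) (- e) e).
  - by rewrite ltW // gtrN.
  - by move=> t _; apply: derivable_horner.
  - by rewrite in_itv /= oppr_lt0 e0.
  - by move=> t; rewrite in_itv /= => te; apply: qmin; rewrite ltr_norml.
by rewrite derivE derive1E; apply: derive_val.
Qed.

Lemma evalv_continuous p : continuous (evalv p).
Proof.
elim/mpoly_ring_ind: p => [c|i|p q cp cq|p q cp cq] x.
- rewrite (_ : evalv _ = fun=> c); first exact: cst_continuous.
  by apply/funext => y; rewrite /evalv mevalC.
- rewrite (_ : evalv _ = fun y => y 0 i); first exact: coord_continuous.
  by apply/funext => y; rewrite /evalv mevalXU.
- rewrite (_ : evalv _ = evalv p \+ evalv q); first exact: cvgD (cp x) (cq x).
  by apply/funext => y; rewrite /evalv mevalD.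
- rewrite (_ : evalv _ = evalv p \* evalv q); first exact: cvgM (cp x) (cq x).
  by apply/funext => y; rewrite /evalv mevalM.
Qed.

Lemma local_min_gradient p x e : 0 < e ->
  (forall y, (forall j, `|y 0 j - x 0 j| < e) -> evalv p x <= evalv p y) ->
  gradient p x = 0.
Proof.
move=> e0 pmin; apply/rowP=> j; rewrite !mxE.
rewrite /evalv -deriv_line0; apply: (poly_local_min e0) => t te.
rewrite !horner_mmap_line.
have -> : (fun i => x 0 i + (i == j)%:R * 0) = (fun i => x 0 i).
  by apply/funext => i; rewrite mulr0 addr0.
pose y : 'rV[R]_n := \row_i (x 0 i + (i == j)%:R * t).
have := pmin y; rewrite /evalv.
have -> : (fun i => y 0 i) = (fun i => x 0 i + (i == j)%:R * t).
  by apply/funext => i; rewrite mxE.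
apply=> i; rewrite mxE addrC addKr.
by case: (i == j); rewrite ?mul1r ?mul0r ?normr0.
Qed.

Variables (m : nat) (f0 : {mpoly R[n]}) (f : 'I_m -> {mpoly R[n]}).

Definition penalty x (kappa : R) : {mpoly R[n]} :=
  f0 + sqdist (x 0) + kappa *: \sum_i f i ^+ 2.

Lemma evalv_penalty x kappa y : evalv (penalty x kappa) y =
  evalv f0 y + evalv (sqdist (x 0)) y + kappa * \sum_i evalv (f i) y ^+ 2.
Proof.
rewrite /evalv 2!mevalD mevalZ; congr (_ + _ * _).
exact: meval_sum_sqr.
Qed.

Lemma sqdist_far x y e l : 0 <= e -> e <= `|y 0 l - x 0 l| ->
  e ^+ 2 <= evalv (sqdist (x 0)) y.
Proof.
move=> e0 le_e; rewrite /evalv meval_sqdist (bigD1 l) //=.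
rewrite -[leLHS]addr0 lerD ?sumr_ge0 // => [|i _]; last exact: sqr_ge0.
by rewrite -[leRHS]real_normK ?num_real // lerXn2r ?nnegrE.
Qed.

(** On a box where [x] is minimal, a large penalty forces the minimizer of
    [penalty] into the interior.  A minimizer on the boundary would lie in the
    compact set [C] of far points where the objective plus the squared distance
    does not exceed the value at [x].  No such point is feasible, the squared
    distance being positive there; so the sum of squares of the constraints has
    a positive minimum on [C], and a large enough [kappa] lifts the penalized
    function above its value at [x]. *)
Lemma penalty_interior_stationary x e : 0 < e -> zero_locus f x ->
  (forall y, (forall l, `|y 0 l - x 0 l| <= e) -> zero_locus f y ->
     evalv f0 x <= evalv f0 y) ->
  exists kappa y, (forall l, `|y 0 l - x 0 l| < e) /\
    gradient (penalty x kappa) y = 0.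
Proof.
move=> e0 fx xmin.
pose B := [set y : 'rV[R]_n | forall l, `[x 0 l - e, x 0 l + e]%classic (y ord0 l)].
have BE y : B y <-> forall l, `|y 0 l - x 0 l| <= e.
  by split=> By l; have := By l; rewrite /= in_itv /= -ler_distl.
have cB : compact B.
  apply: (@rV_compact _ n (fun l => `[x 0 l - e, x 0 l + e]%classic)) => l.
  exact: segment_compact.
have Bx : B x by apply/BE => l; rewrite subrr normr0 ltW.
pose G y := evalv (f0 + sqdist (x 0)) y.
pose g y := evalv (\sum_i f i ^+ 2) y.
have gE y : g y = \sum_i evalv (f i) y ^+ 2.
  exact: meval_sum_sqr.
have g_ge0 y : 0 <= g y by rewrite gE sumr_ge0 // => i _; apply: sqr_ge0.
have penE kappa y : evalv (penalty x kappa) y = G y + kappa * g y.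
  by rewrite evalv_penalty gE /G /evalv mevalD.
have dxx : evalv (sqdist (x 0)) x = 0.
  by rewrite /evalv meval_sqdist big1 // => l _; rewrite subrr expr0n.
have Gx : G x = evalv f0 x by rewrite /G /evalv mevalD -!/(evalv _ _) dxx addr0.
have gx : g x = 0 by rewrite gE big1 // => i _; rewrite fx expr0n.
pose C := B `&` ([set y | G y <= evalv f0 x] `&`
                 [set y | e ^+ 2 <= evalv (sqdist (x 0)) y]).
have cG : continuous G by apply: evalv_continuous.
have cg : continuous g by apply: evalv_continuous.
have cC : compact C.
  apply: compact_closedI => //; apply: closedI.
    apply: (@preimage_closed _ _ G [set z | z <= evalv f0 x]); last exact: closed_le.
    by move=> y _; apply: cG.
  apply: (@preimage_closed _ _ (evalv (sqdist (x 0))) [set z | e ^+ 2 <= z]).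
    by move=> y _; apply: evalv_continuous.
  exact: closed_ge.
have g_gt0 y : C y -> 0 < g y.
  move=> [/BE By [Gy dy]]; rewrite lt_neqAle g_ge0 andbT eq_sym.
  apply/eqP => gy0.
  have fy : zero_locus f y.
    move=> i; apply/eqP; rewrite -sqrf_eq0; move: gy0; rewrite gE => /eqP.
    rewrite psumr_eq0 => [/allP/(_ i)|l _]; last exact: sqr_ge0.
    by rewrite mem_index_enum => /(_ isT).
  have := xmin y By fy; apply/negP; rewrite -ltNge.
  apply: lt_le_trans Gy; rewrite /G /evalv mevalD ltrDl.
  by apply: lt_le_trans dy; rewrite exprn_gt0.
have [kappa kappa0 kappaC] : exists2 kappa, 0 <= kappa &
    forall y, C y -> evalv f0 x < G y + kappa * g y.
  have [C0|/set0P/negP/negPn/eqP C0] := pselect (C !=set0); last first.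
    by exists 0 => // y; rewrite C0.
  have [c /set_mem Cc cmin] := compact_EVT_min C0 cC (continuous_subspaceT cg).
  have [b /set_mem Cb bmin] := compact_EVT_min C0 cC (continuous_subspaceT cG).
  have gc0 := g_gt0 c Cc; have [_ [/= Gb _]] := Cb.
  exists ((evalv f0 x - G b) / g c + 1).
    by rewrite addr_ge0 // divr_ge0 ?subr_ge0 // ltW.
  move=> y /mem_set Cy; have := bmin y Cy; have := cmin y Cy => gcy Gby.
  apply: (@lt_le_trans _ _ (G b + ((evalv f0 x - G b) / g c + 1) * g c)).
    by rewrite mulrDl divfK ?gt_eqF // mul1r addrA subrKC ltrDl.
  by rewrite lerD // ler_wpM2l // addr_ge0 // divr_ge0 ?subr_ge0 // ltW.
have [y /set_mem By ymin] := compact_EVT_min (ex_intro _ x Bx) cB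
  (continuous_subspaceT (@evalv_continuous (penalty x kappa))).
have yx : G y + kappa * g y <= evalv f0 x.
  by have := ymin x (mem_set Bx); rewrite !penE gx mulr0 addr0 Gx.
have Gy : G y <= evalv f0 x.
  by apply: le_trans yx; rewrite lerDl mulr_ge0.
have y_int l : `|y 0 l - x 0 l| < e.
  rewrite ltNge; apply/negP => le_e.
  have Cy : C y by split=> //; split=> //=; apply: sqdist_far le_e; apply: ltW.
  by have := kappaC y Cy; rewrite ltNge yx.
exists kappa, y; split=> //.
(* The distance of [y] to the faces of the box. *)
pose r := \big[Num.min/e]_l (e - `|y 0 l - x 0 l|).
apply: (@local_min_gradient _ y r).
  by rewrite /r; elim/big_ind: _ => // [a b a0 b0|l _]; rewrite ?lt_min ?a0 // subr_gt0.
move=> z zy; apply: ymin; apply/mem_set/BE => l.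
have := zy l => /ltW zl.
have : r <= e - `|y 0 l - x 0 l| by apply: bigmin_le_cond.
move=> rl; rewrite -[_ - _](subrKA (y 0 l)).
apply: le_trans (ler_normD _ _) _.
by rewrite -lerBrDr (le_trans zl).
Qed.

(** Near [x] there are points where the objective gradient, corrected by
    [2 (y - x)], is in the span of the constraint gradients; the multipliers
    there may be unbounded a priori, but [span_defect] does not involve them and
    passes to the limit. *)
Lemma lagrange_multipliers x :
  free [tuple gradient (f i) x | i < m] -> local_minimizer f0 f x ->
  kkt_stationary f0 f x.
Proof.
move=> f_free [fx /nbhs_ballP[e /= e0 xmin]].
pose G : 'M[{mpoly R[n]}]_(m, n) := \matrix_(i, l) (f i)^`M(l).
pose v : 'rV[{mpoly R[n]}]_n :=
  \row_l (f0^`M(l) + ('X_l - (x 0 l)%:MP) *+ 2).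
have GE y i : row i (map_mx (meval (fun l => y 0 l)) G) = gradient (f i) y.
  by apply/rowP=> l; rewrite !mxE.
have W_near (d : R) : 0 < d -> exists y, (forall l, `|y 0 l - x 0 l| < d) /\
    map_mx (meval (fun l => y 0 l)) (span_defect G v) = 0.
  move=> d0.
  (* Halving [e] puts the closed box inside the open ball of minimality. *)
  pose r := Num.min d (e / 2).
  have r0 : 0 < r by rewrite lt_min d0 divr_gt0.
  have [|kappa [y [yx]]] := penalty_interior_stationary r0 fx.
    move=> y yr fy; apply: xmin => //; split=> // i l.
    rewrite ord1 /ball /= distrC; apply: le_lt_trans (yr l) _.
    by rewrite gt_min ltr_pdivrMr // ltr_pMr // ltr1n orbT.
  move=> /rowP pen0; exists y; split.
    by move=> l; apply: lt_le_trans (yx l) _; rewrite ge_min lexx.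
  rewrite map_span_defect.
  pose u : 'rV[R]_m := \row_i - (kappa * (evalv (f i) y *+ 2)).
  suff -> : map_mx (meval (fun l => y 0 l)) v =
            u *m map_mx (meval (fun l => y 0 l)) G by apply: span_defect_span.
  apply/rowP=> l; have := pen0 l; rewrite !mxE /evalv.
  rewrite 2!mderivD mderivZ mderiv_sqdist 2!mevalD mevalZ => /eqP.
  rewrite addr_eq0 mevalD => /eqP ->.
  rewrite meval_mderiv_sum_sqr mulr_sumr -sumrN; apply: eq_bigr => i _.
  by rewrite !mxE mulrA mulNr.
have W0 : map_mx (meval (fun l => x 0 l)) (span_defect G v) = 0.
  apply/rowP=> l; rewrite mxE [in RHS]mxE; apply/eqP.
  set w := span_defect G v 0 l; rewrite -/(evalv w x); apply/negPn/negP => wx.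
  have /nbhs_ballP[d /= d0 dw] : nbhs x [set y | evalv w y != 0].
    exact: cvgr_neq0 (@evalv_continuous w x) wx.
  have [y [yx /rowP/(_ l)]] := W_near d d0.
  rewrite mxE [in RHS]mxE -/w -/(evalv w y) => wy.
  suff : evalv w y != 0 by rewrite wy eqxx.
  by apply: dw; split=> // i l'; rewrite ord1 /ball /= distrC; apply: yx.
have [|u] := span_defect_eq0 _ (etrans (esym (map_span_defect _ _ _)) W0).
  apply: gram_det_neq0 => u uG; apply/rowP => i; rewrite mxE.
  move/free_gradientsP: f_free => /(_ (fun i => u 0 i)); apply.
  by rewrite -[RHS]uG mulmx_sum_row; apply: eq_bigr => i' _; rewrite GE.
have -> : map_mx (meval (fun l => x 0 l)) v = gradient f0 x.
  apply/rowP=> l.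
  by rewrite !mxE mevalD mevalMn mevalB mevalXU mevalC subrr mul0rn addr0.
move=> vu; exists (fun i => - u 0 i); rewrite vu mulmx_sum_row -big_split /=.
by apply: big1 => i _; rewrite GE scaleNr subrr.
Qed.

End Lagrange.

(** * Genericity *)

Lemma finite_root_grid (K : closedFieldType) n (q : 'I_n -> {poly K})
    (S : set 'rV[K]_n) :
  (forall l, q l != 0) -> (forall x, S x -> forall l, root (q l) (x 0 l)) ->
  finite_set S.
Proof.
move=> q0 Sq; pose r := flatten [seq sval (closed_field_poly_normal (q l)) | l : 'I_n].
have r_root l t : root (q l) t -> t \in r.
  case E : (closed_field_poly_normal (q l)) => [s def_q] qt.
  apply/flatten_mapP; exists l; rewrite ?mem_enum // E /=.
  by move: qt; rewrite def_q rootZ ?lead_coef_eq0 // root_prod_XsubC.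
apply: (@sub_finite_set _ _
  ((fun g : {ffun 'I_n -> seq_sub r} => \row_l ssval (g l)) @` setT)).
  move=> x Sx /=.
  have xr l : x 0 l \in r by apply: r_root (Sq x Sx l).
  exists [ffun l => SeqSub (xr l)] => //.
  by apply/rowP=> l; rewrite mxE ffunE.
exact/finite_image/finite_finset.
Qed.

Lemma generically_nonvanishing (F : numFieldType) n k (d : 'I_k -> nat)
    (S : ('I_k -> {mpoly F[n]}) -> Prop) (P : {mpoly F[#|coef_index n d|]}) :
  P != 0 ->
  (forall f, (forall i, (msize (f i) <= (d i).+1)%N) ->
     P.@[fun m => @coef_tuple F n k d f (enum_val m)] != 0 -> S f) ->
  @generically F n k d S.
Proof.
move=> P0 PS; exists [set c | P.@[fun m => c (enum_val m)] != 0]; split.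
- exists [set P]; apply/seteqP; split=> c /=.
    by move=> /negP/negPn/eqP Pc _ ->.
  by move=> /(_ P erefl) ->; rewrite eqxx.
- have [v Pv] := mpoly_nonzero_point P0.
  exists (fun u => v (enum_rank u)) => /=.
  by rewrite (meval_eq _ (v2 := v)) // => m; rewrite enum_valK.
- by move=> f fd Pf; apply: PS => // i; rewrite fd.
Qed.

(** A linear relation [mu] between the gradients with [mu j != 0] makes the
    point critical for [f j] with multipliers [mu i / mu j] and critical value
    [0]. *)
Lemma smooth_locus_noncritical (K : fieldType) n m (f : 'I_m -> {mpoly K[n]}) :
  (forall j x, constrained_critical j f x -> (f j).@[x] != 0) -> smooth_locus f.
Proof.
move=> f_crit x fx; apply/free_gradientsP => mu mu_sum j; apply/eqP/negPn/negP => muj.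
suff /f_crit/eqP : constrained_critical j f (fun l => x 0 l) by apply; apply: fx.
split=> [i _|]; first exact: fx.
exists (fun i => mu i / mu j) => l.
have := congr1 (fun v : 'rV_n => (mu j)^-1 * v 0 l) mu_sum.
rewrite [in RHS]mxE mulr0 summxE (bigD1 j) //= mulrDr => mu0.
rewrite -[RHS]mu0; congr (_ + _).
  by rewrite !mxE mulrA mulVf // mul1r.
rewrite mulr_sumr; apply: eq_bigr => i _.
by rewrite !mxE mulrA [_^-1 * _]mulrC.
Qed.

Lemma gradient_map_mpoly (A B : comNzRingType) (theta : {rmorphism A -> B}) n
    (p : {mpoly A[n]}) (x : 'rV[A]_n) :
  gradient (map_mpoly theta p) (map_mx theta x) = map_mx theta (gradient p x).
Proof.
apply/rowP=> l; rewrite !mxE /evalv mderiv_map_mpoly -meval_map_mpoly.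
by apply: meval_eq => i; rewrite mxE.
Qed.

Lemma free_gradients_real (R : realType) n m (f : 'I_m -> {mpoly R[n]}) x :
  smooth_locus (complexifys f) -> zero_locus f x ->
  free [tuple gradient (f i) x | i < m].
Proof.
move=> f_smooth fx.
have /f_smooth/free_gradientsP free_x :
    zero_locus (complexifys f) (map_mx (real_complex R) x).
  move=> i; have := meval_map_mpoly (real_complex R) (fun l => x 0 l) (f i).
  rewrite -/(evalv (f i) x) fx rmorph0 => <-.
  by apply: meval_eq => l; rewrite mxE.
apply/free_gradientsP => mu mu_sum i.
apply: (fmorph_inj (real_complex R)); rewrite rmorph0.
apply: (free_x (fun i => real_complex R (mu i))).
transitivity (map_mx (real_complex R)
  (\sum_i mu i *: gradient (f i) x)); last first.
  by rewrite mu_sum map_mx0.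
rewrite (raddf_sum (map_mx (real_complex R))); apply: eq_bigr => i' _ /=.
by rewrite gradient_map_mpoly map_mxZ.
Qed.

Theorem proposition2p1 (R : realType) (n m : nat) (d : 'I_m.+1 -> nat)
    (hmn : (m <= n)%N) (hn : (1 <= n)%N) (hd : forall i, (1 <= d i)%N) :
  (* f_1, ..., f_m generic *)
  @generically R n m (constraints d) (fun f =>
      smooth_locus (complexifys f)
      /\
      (forall f0 : {mpoly R[n]}, msize f0 = (d ord0).+1 ->
       forall x : 'rV[R]_n,
         local_minimizer f0 f x \/ global_minimizer f0 f x ->
         kkt_stationary f0 f x /\ zero_locus f x))
  /\
  (* f_0, f_1, ..., f_m generic *)
  @generically R n m.+1 d (fun f =>
      finite_set [set x : 'rV[R[i]]_n |
        zero_locus (complexifys (constraints f)) x /\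
        kkt_stationary (complexify (f ord0)) (complexifys (constraints f)) x]).
Proof.
split.
  have crit j := @generic_critical_values_nonzero R n m (constraints d) j (hd _).
  pose P j := s2val (cid2 (crit j)).
  apply: (@generically_nonvanishing _ _ _ _ _ (\prod_j P j)).
    by apply/prodf_neq0 => j _; rewrite /P; case: cid2.
  move=> f f_deg; rewrite rmorph_prod => /prodf_neq0 Pf.
  have f_smooth : smooth_locus (complexifys f).
    apply: smooth_locus_noncritical => j x.
    have := Pf j isT; rewrite /P; case: cid2 => q /= _ qcrit qf.
    exact: (qcrit _ (real_complex R) f f_deg qf).
  split=> // f0 _ x xmin.
  have x_loc : local_minimizer f0 f x.
    case: xmin => // -[fx xglob]; split=> //.
    by apply/nbhs_ballP; exists 1 => //= y _; apply: xglob.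
  have fx := x_loc.1; split=> //.
  by apply: lagrange_multipliers x_loc; apply: free_gradients_real.
have [P P0 Pcrit] := @generic_critical_points_algebraic R n m.+1 d ord0 (hd _).
apply: (generically_nonvanishing P0) => f f_deg Pf.
have [q qcrit] := Pcrit _ (real_complex R) f f_deg Pf.
apply: (@finite_root_grid _ _ q) => [l|x [fx [lambda kkt]] l].
  by have [] := qcrit l.
have [_ /(_ (fun l => x 0 l))] := qcrit l; apply; split.
  by move=> i; case: (unliftP ord0 i) => [i' -> _|->]; [exact: fx|rewrite eqxx].
exists (fun i => if unlift ord0 i is Some i' then lambda i' else 0) => l'.
have := congr1 (fun v : 'rV_n => v 0 l') kkt.
rewrite mxE [in RHS]mxE summxE => kkt0.
rewrite -[RHS]kkt0 mxE; congr (_ + _).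
rewrite big_mkcond big_ord_recl eqxx /= add0r; apply: eq_bigr => i _.
by rewrite liftK !mxE.
Qed.
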